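(* Fix $n\in\mathbb N$ and let $\pi_0<_{lex}\pi_1<_{lex}\dots<_{lex}\pi_k$ be the list of all fixed points of PSSPM($n$), ordered lexicographically. Then $\pi_0\triangleleft\pi_1\triangleleft\dots\triangleleft\pi_{k-1}\triangleleft\pi_k$. Moreover, for every fixed point $\pi$ of SSPM($n$) with $\pi_0\le_{lex}\pi\le_{lex}\pi_k$, there exists an index $i$, $0\le i\le k$, with $\pi_i=\pi$.
   Context: A configuration is a sequence $(c_i)_{i\in\mathbb Z}$ of nonnegative integers with only finitely many positive values; $(\underline{n})$ denotes the configuration with $c_0=n$ and $c_i=0$ otherwise. Rule $\mathcal L$ at column $i$ is applicable if $c_{i-1}+2\le c_i$ and moves one grain from column $i$ to column $i-1$; rule $\mathcal R$ at column $i$ is applicable if $c_i\ge c_{i+1}+2$ and moves one grain from column $i$ to column $i+1$. An SSPM transition applies exactly one applicable rule at one column. A PSSPM transition applies rules simultaneously on every column where some rule is applicable, at most one rule per column (choosing one when both apply). SSPM($n$) (resp. PSSPM($n$)) is the set of configurations reachable from $(\underline{n})$ by finitely many SSPM (resp. PSSPM) transitions; a fixed point of SSPM($n$) (resp. PSSPM($n$)) is an element of that set on which no rule is applicable. Lexicographic order: $a<_{lex} b$ iff $a\ne b$ and $a_i<b_i$ at the smallest index $i$ with $a_i\ne b_i$. For configurations $a,b$, $a\triangleleft b$ means: there exist indices $i<j$ with $a_i-b_i=-1$, $a_j-b_j=1$, and $a_m=b_m$ for all $m\notin\{i,j\}$. *)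

(* Defs.v *)
From Stdlib Require Import ZArith List Lia.
Open Scope Z_scope.

Definition config := Z -> nat.

Definition single (n : nat) : config := fun i => if Z.eqb i 0 then n else 0%nat.

Definition L_applicable (c : config) (i : Z) : Prop := (c (i - 1)%Z + 2 <= c i)%nat.
Definition R_applicable (c : config) (i : Z) : Prop := (c (i + 1)%Z + 2 <= c i)%nat.

Definition moveL (c : config) (i : Z) : config :=
  fun j => if Z.eqb j i then (c i - 1)%nat
           else if Z.eqb j (i - 1) then (c j + 1)%nat else c j.
Definition moveR (c : config) (i : Z) : config :=
  fun j => if Z.eqb j i then (c i - 1)%nat
           else if Z.eqb j (i + 1) then (c j + 1)%nat else c j.

Definition sspm_step (c c' : config) : Prop :=
  exists i, (L_applicable c i /\ c' = moveL c i) \/ (R_applicable c i /\ c' = moveR c i).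

Inductive rule := RuleL | RuleR.

Definition valid_choice (c : config) (ch : Z -> option rule) : Prop :=
  forall i, match ch i with
            | Some RuleL => L_applicable c i
            | Some RuleR => R_applicable c i
            | None => ~ L_applicable c i /\ ~ R_applicable c i
            end.

Definition fires (o : option rule) : nat := match o with None => 0%nat | Some _ => 1%nat end.
Definition firesL (o : option rule) : nat := match o with Some RuleL => 1%nat | _ => 0%nat end.
Definition firesR (o : option rule) : nat := match o with Some RuleR => 1%nat | _ => 0%nat end.

Definition apply_choice (c : config) (ch : Z -> option rule) : config :=
  fun i => (c i - fires (ch i) + firesL (ch (i + 1)%Z) + firesR (ch (i - 1)%Z))%nat.

Definition psspm_step (c c' : config) : Prop :=
  exists ch, valid_choice c ch /\ c' = apply_choice c ch.

Inductive reachable (step : config -> config -> Prop) (n : nat) : config -> Prop :=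
| reach_base : reachable step n (single n)
| reach_step : forall c c', reachable step n c -> step c c' -> reachable step n c'.

Definition is_fixed (c : config) : Prop :=
  forall i, ~ L_applicable c i /\ ~ R_applicable c i.

Definition SSPM_fixed (n : nat) (c : config) : Prop := reachable sspm_step n c /\ is_fixed c.
Definition PSSPM_fixed (n : nat) (c : config) : Prop := reachable psspm_step n c /\ is_fixed c.

Definition lex_lt (a b : config) : Prop :=
  exists i, (forall j, j < i -> a j = b j) /\ (a i < b i)%nat.
Definition lex_le (a b : config) : Prop := a = b \/ lex_lt a b.

Definition tri (a b : config) : Prop :=
  exists i j, i < j /\ b i = (a i + 1)%nat /\ a j = (b j + 1)%nat /\
    (forall m, m <> i -> m <> j -> a m = b m).

Definition zero_config : config := fun _ => 0%nat.

(* Main.v *)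
(** A step subtracts from the prefix sums [A] of a configuration the flow [f]
    across each edge, and the direction of this flow depends only on the second
    difference of [A]. Hence the parallel dynamics is monotone in [A], and it
    preserves the relation [A <= B <= A + 1] between two trajectories, provided
    that a column free to fall either way imitates the other trajectory. The two
    outcomes of one choice are related in this way, so the set of configurations
    reached after [t] steps is connected for this relation at every time [t],
    and so is the set of fixed points.

    Fixed points are "peaked" (at most one plateau on each side), so the
    difference of two of them changes sign only once. Related fixed points then
    differ by one grain, and the only fixed point that can lie strictly between
    them is a pyramid. The latter is excluded by an extra condition [good] that
    is preserved along related trajectories. Connectedness therefore leaves no
    gap in the lexicographic order. *)

Require Import Defs.
From Stdlib Require Import ZArith List.
From Stdlib Require Import Lia Classical FunctionalExtensionality Relations.

(** * Discrete calculus on Z *)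

Lemma antitone_le (F : Z -> Z) (a b : Z) :
  (forall k, a < k <= b -> F k <= F (k - 1)) -> a <= b -> F b <= F a.
Proof.
  intros H ab.
  replace b with (a + Z.of_nat (Z.to_nat (b - a))) in * by lia.
  remember (Z.to_nat (b - a)) as l eqn:El; clear El ab.
  induction l as [|l IH].
  - replace (a + Z.of_nat 0) with a by lia; lia.
  - assert (E := H (a + Z.of_nat (S l)) ltac:(lia)).
    replace (a + Z.of_nat (S l) - 1) with (a + Z.of_nat l) in E by lia.
    apply Z.le_trans with (1 := E), IH; intros k Hk; apply H; lia.
Qed.

Lemma monotone_le (F : Z -> Z) (a b : Z) :
  (forall k, a < k <= b -> F (k - 1) <= F k) -> a <= b -> F a <= F b.
Proof.
  intros H ab.
  assert (E := antitone_le (fun k => - F k) a b).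
  cbn in E; assert (forall k, a < k <= b -> - F k <= - F (k - 1)) as H'.
  { intros k Hk; specialize (H k Hk); lia. }
  specialize (E H' ab); lia.
Qed.

Lemma decrease_point (F : Z -> Z) (a b : Z) :
  a <= b -> F b < F a -> exists e, a < e <= b /\ F e < F (e - 1).
Proof.
  intros ab lt; apply NNPP; intro N.
  assert (F a <= F b); [|lia].
  apply monotone_le; [|exact ab]; intros k Hk.
  destruct (Z.le_gt_cases (F (k - 1)) (F k)) as [|L]; [assumption|].
  exfalso; apply N; exists k; split; [lia|lia].
Qed.

Lemma increase_point (F : Z -> Z) (a b : Z) :
  a <= b -> F a < F b -> exists e, a < e <= b /\ F (e - 1) < F e.
Proof.
  intros ab lt.
  destruct (decrease_point (fun k => - F k) a b ab) as [e [He L]]; [cbn; lia|].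
  exists e; cbn in L; split; [exact He|lia].
Qed.

(** Agreement left of [a] makes the descent well founded: an earlier difference is strictly closer
    to [a]. *)
Lemma first_difference (x y : config) (a k : Z) :
  (forall j, j < a -> x j = y j) -> x k <> y k ->
  exists d, x d <> y d /\ forall j, j < d -> x j = y j.
Proof.
  intros Ha; remember (Z.to_nat (k - a)) as l eqn:El.
  revert k El; induction l as [l IH] using lt_wf_ind; intros k El ne.
  destruct (classic (forall j, j < k -> x j = y j)) as [Y|N].
  - exists k; split; assumption.
  - apply not_all_ex_not in N as [j N].
    apply imply_to_and in N as [jk N].
    assert (a <= j) by (apply Z.nlt_ge; intro; apply N; auto).
    apply (IH (Z.to_nat (j - a)) ltac:(lia) j eq_refl N).
Qed.

(** * Prefix sums and peaked configurations *)

(** The recurrence determines [A] up to a constant; the boundary clause fixes it and encodes finite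
    support and the total of [n] grains. *)
Definition rep (n : nat) (A : Z -> Z) (x : config) : Prop :=
  (forall k, A k = A (k - 1) + Z.of_nat (x k)) /\
  exists b, forall k, (k < - b -> A k = 0) /\ (b < k -> A k = Z.of_nat n).

(* Right of the split [p] two columns of equal height must be separated by a
   drop of at least 2, and symmetrically on the left. *)
Definition peaked (x : config) : Prop :=
  exists p,
    (forall i j, p < i < j ->
       x j = 0%nat \/ Z.of_nat (x j) + (j - i) <= Z.of_nat (x i) + 1) /\
    (forall i j, j < i <= p ->
       x j = 0%nat \/ Z.of_nat (x j) + (i - j) <= Z.of_nat (x i) + 1).

Lemma rep_bounds n A x k : rep n A x -> 0 <= A k <= Z.of_nat n.
Proof.
  intros [HA [b Hb]].
  assert (A (Z.min k (- b - 1)) = 0) by (apply Hb; lia).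
  assert (A (Z.max k (b + 1)) = Z.of_nat n) by (apply Hb; lia).
  assert (A (Z.min k (- b - 1)) <= A k).
  { apply monotone_le; [|lia]; intros j _; rewrite (HA j); lia. }
  assert (A k <= A (Z.max k (b + 1))).
  { apply monotone_le; [|lia]; intros j _; rewrite (HA j); lia. }
  lia.
Qed.

Lemma rep_common n A B x y : rep n A x -> rep n B y ->
  exists b, 0 <= b /\ forall k, (k < - b -> A k = 0 /\ B k = 0) /\
    (b < k -> A k = Z.of_nat n /\ B k = Z.of_nat n).
Proof.
  intros [_ [b Hb]] [_ [c Hc]]; exists (Z.max 0 (Z.max b c)); split; [lia|].
  intros k; split; intro H; split; first [apply Hb; lia | apply Hc; lia].
Qed.

Lemma rep_unique n A B x : rep n A x -> rep n B x -> forall k, A k = B k.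
Proof.
  intros RA RB k.
  destruct (rep_common _ _ _ _ _ RA RB) as [b [_ Hb]].
  destruct RA as [HA _], RB as [HB _].
  assert (E1 := antitone_le (fun k => A k - B k) (Z.min k (- b - 1)) k).
  assert (E2 := monotone_le (fun k => A k - B k) (Z.min k (- b - 1)) k).
  cbn in E1, E2.
  destruct (Hb (Z.min k (- b - 1))) as [Hl _].
  specialize (Hl ltac:(lia)).
  assert (A k - B k <= 0).
  { replace 0 with (A (Z.min k (- b - 1)) - B (Z.min k (- b - 1))) by lia.
    apply E1; [|lia]; intros j _; rewrite (HA j), (HB j); lia. }
  assert (0 <= A k - B k).
  { replace 0 with (A (Z.min k (- b - 1)) - B (Z.min k (- b - 1))) at 1 by lia.
    apply E2; [|lia]; intros j _; rewrite (HA j), (HB j); lia. }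
  lia.
Qed.

Definition single_sum (n : nat) (k : Z) : Z := if Z.ltb k 0 then 0 else Z.of_nat n.

Lemma rep_single n : rep n (single_sum n) (single n).
Proof.
  unfold single_sum, single; split.
  - intro k; destruct (Z.ltb_spec k 0), (Z.ltb_spec (k - 1) 0), (Z.eqb_spec k 0); lia.
  - exists 0; intro k; destruct (Z.ltb_spec k 0); lia.
Qed.

Lemma peaked_single n : peaked (single n).
Proof.
  exists 0; unfold single; split; intros i j H; destruct (Z.eqb_spec j 0); lia.
Qed.

(** * Flows *)

(* [f k] is the number of grains crossing from column [k] to column [k + 1]. *)
Record flow (x : config) (f : Z -> Z) (x' : config) : Prop := {
  flow_range : forall k, -1 <= f k <= 1;
  flow_right : forall k, f k = 1 -> (x (k + 1)%Z + 2 <= x k)%nat;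
  flow_left : forall k, f k = -1 -> (x k + 2 <= x (k + 1)%Z)%nat;
  flow_once : forall k, f (k - 1) = -1 -> f k = 1 -> False;
  flow_upd : forall k, Z.of_nat (x' k) = Z.of_nat (x k) - f k + f (k - 1)
}.

Definition flow_sum (A f : Z -> Z) : Z -> Z := fun k => A k - f k.

Lemma rep_flow n A x f x' : rep n A x -> flow x f x' -> rep n (flow_sum A f) x'.
Proof.
  intros [HA [b Hb]] F; unfold flow_sum; split.
  - intro k; rewrite (flow_upd _ _ _ F k), (HA k); lia.
  (* Beyond [b + 1] both columns at edge [k] are empty, so nothing crosses it. *)
  - exists (b + 1); intro k.
    assert (R := flow_range _ _ _ F k).
    assert (f1 := flow_right _ _ _ F k).
    assert (f2 := flow_left _ _ _ F k).
    assert (H0 := HA k); assert (H1 := HA (k + 1)).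
    replace (k + 1 - 1) with k in H1 by lia.
    destruct (Hb (k - 1)) as [l1 r1], (Hb k) as [l2 r2], (Hb (k + 1)) as [l3 r3].
    split; intro Hk; lia.
Qed.

(** If the split edge carries flow, its height drop of at least two lets the upper column change
    sides. The split moves by one edge, and the new edge carries no flow: [flow_once] excludes one
    direction, the slope on that side the other. *)
Lemma flow_split x f x' : peaked x -> flow x f x' ->
  exists p, f p = 0 /\
    (forall i j, p < i < j ->
       x j = 0%nat \/ Z.of_nat (x j) + (j - i) <= Z.of_nat (x i) + 1) /\
    (forall i j, j < i <= p ->
       x j = 0%nat \/ Z.of_nat (x j) + (i - j) <= Z.of_nat (x i) + 1).
Proof.
  intros [p [HR HL]] F.
  assert (R := flow_range _ _ _ F).
  assert (fp : f p = 0 \/ f p = 1 \/ f p = -1) by (specialize (R p); lia).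
  destruct fp as [fp | [fp | fp]].
  - exists p; auto.
  - assert (D := flow_right _ _ _ F p fp).
    exists (p - 1); repeat split.
    + assert (O := flow_once _ _ _ F p).
      assert (D' := flow_right _ _ _ F (p - 1)).
      replace (p - 1 + 1) with p in D' by lia.
      assert (L := HL p (p - 1) ltac:(lia)).
      specialize (R (p - 1)); lia.
    + intros i j H; destruct (Z.eq_dec i p) as [->|].
      * destruct (Z.eq_dec j (p + 1)) as [->|]; [lia|].
        destruct (HR (p + 1) j ltac:(lia)); lia.
      * apply HR; lia.
    + intros i j H; apply HL; lia.
  - assert (D := flow_left _ _ _ F p fp).
    exists (p + 1); repeat split.
    + assert (O := flow_once _ _ _ F (p + 1)).
      replace (p + 1 - 1) with p in O by lia.
      assert (D' := flow_left _ _ _ F (p + 1)).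
      assert (L := HR (p + 1) (p + 1 + 1) ltac:(lia)).
      specialize (R (p + 1)); lia.
    + intros i j H; apply HR; lia.
    + intros i j H; destruct (Z.eq_dec i (p + 1)) as [->|].
      * destruct (Z.eq_dec j p) as [->|]; [lia|].
        destruct (HL p j ltac:(lia)); lia.
      * apply HL; lia.
Qed.

(** Heights weakly decrease away from the split, so grains only move outwards. *)
Lemma flow_signs x f x' p : flow x f x' -> f p = 0 ->
  (forall i j, p < i < j ->
     x j = 0%nat \/ Z.of_nat (x j) + (j - i) <= Z.of_nat (x i) + 1) ->
  (forall i j, j < i <= p ->
     x j = 0%nat \/ Z.of_nat (x j) + (i - j) <= Z.of_nat (x i) + 1) ->
  forall k, (p <= k -> 0 <= f k) /\ (k <= p -> f k <= 0).
Proof.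
  intros F fp HR HL k; assert (R := flow_range _ _ _ F k).
  assert (f1 := flow_right _ _ _ F k).
  assert (f2 := flow_left _ _ _ F k).
  assert (k = p \/ k < p \/ p < k) as [->|[H|H]] by lia.
  - lia.
  - assert (E := HL (k + 1) k ltac:(lia)); lia.
  - assert (E := HR k (k + 1) ltac:(lia)); lia.
Qed.

Lemma peaked_flow x f x' : peaked x -> flow x f x' -> peaked x'.
Proof.
  intros Px F; destruct (flow_split _ _ _ Px F) as [p [fp [HR HL]]].
  assert (S := flow_signs _ _ _ _ F fp HR HL).
  assert (R := flow_range _ _ _ F).
  assert (U := flow_upd _ _ _ F).
  exists p; split; intros i j H.
  - assert (Ui := U i); assert (Uj := U j).
    assert (Ri := R i); assert (Rj := R (j - 1)).
    assert (S1 := S (i - 1)); assert (S2 := S i); assert (S3 := S j);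
      assert (S4 := S (j - 1)).
    assert (D1 := flow_right _ _ _ F i); assert (D2 := flow_right _ _ _ F (j - 1)).
    replace (j - 1 + 1) with j in D2 by lia.
    assert (H1 := HR i j H).
    (* A grain leaving [i] rightwards reveals a drop of two to [i + 1], one entering [j] from
       [j - 1] a drop of two from there; the inequalities for these inner columns absorb the
       changes. At distances one and two the inner columns cross or coincide. *)
    destruct (Z.eq_dec j (i + 1)) as [->|].
    + replace (i + 1 - 1) with i in * by lia; lia.
    + assert (H2 := HR i (j - 1) ltac:(lia)).
      assert (H3 := HR (i + 1) j ltac:(lia)).
      destruct (Z.eq_dec j (i + 2)) as [->|].
      * replace (i + 2 - 1) with (i + 1) in * by lia; lia.
      * assert (H4 := HR (i + 1) (j - 1) ltac:(lia)); lia.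
  - assert (Ui := U i); assert (Uj := U j).
    assert (Ri := R (i - 1)); assert (Rj := R j).
    assert (S1 := S (i - 1)); assert (S2 := S i); assert (S3 := S j);
      assert (S4 := S (j - 1)).
    assert (D1 := flow_left _ _ _ F (i - 1)); assert (D2 := flow_left _ _ _ F j).
    replace (i - 1 + 1) with i in D1 by lia.
    assert (H1 := HL i j H).
    destruct (Z.eq_dec i (j + 1)) as [->|].
    + replace (j + 1 - 1) with j in * by lia; lia.
    + assert (H2 := HL i (j + 1) ltac:(lia)).
      assert (H3 := HL (i - 1) j ltac:(lia)).
      destruct (Z.eq_dec i (j + 2)) as [->|].
      * replace (j + 2 - 1) with (j + 1) in * by lia; lia.
      * assert (H4 := HL (i - 1) (j + 1) ltac:(lia)); lia.
Qed.

(** * Stable peaked configurations *)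

Lemma fixed_slope x : is_fixed x -> forall i j, i <= j ->
  Z.of_nat (x j) <= Z.of_nat (x i) + (j - i) /\
  Z.of_nat (x i) <= Z.of_nat (x j) + (j - i).
Proof.
  intros Fx i j ij; unfold is_fixed, L_applicable, R_applicable in Fx.
  assert (E1 := antitone_le (fun k => Z.of_nat (x k) - k) i j).
  assert (E2 := monotone_le (fun k => Z.of_nat (x k) + k) i j).
  cbn beta in E1, E2; split.
  - enough (Z.of_nat (x j) - j <= Z.of_nat (x i) - i) by lia.
    apply E1; [|lia]; intros k _; destruct (Fx k); lia.
  - enough (Z.of_nat (x i) + i <= Z.of_nat (x j) + j) by lia.
    apply E2; [|lia]; intros k _; destruct (Fx (k - 1)) as [_ H].
    replace (k - 1 + 1) with k in H by lia; lia.
Qed.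

(* A peaked [y] changes slope only at its split, so it cannot go above,
   below and again above a configuration of slope at most 1. *)
Lemma no_double_crossing x y i e j : is_fixed x -> peaked y -> i < e < j ->
  (x i < y i)%nat -> (y e < x e)%nat -> (x j < y j)%nat -> False.
Proof.
  intros Fx [p [HR HL]] H yi ye yj.
  destruct (Z.le_gt_cases e p) as [ep|ep].
  - assert (E := HL e i ltac:(lia)).
    assert (G := fixed_slope x Fx i e ltac:(lia)); lia.
  - assert (E := HR e j ltac:(lia)).
    assert (G := fixed_slope x Fx e j ltac:(lia)); lia.
Qed.

Lemma tri_lex_lt x y : tri x y -> lex_lt x y.
Proof.
  intros [i [j [ij [Hi [Hj H]]]]]; exists i; split; [|lia].
  intros k ki; apply H; lia.
Qed.

(** The difference [F] of the prefix sums is 0 or 1 and vanishes at both ends. A second rise or a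
    second fall would make [y - x] alternate in sign three times, so [F] is the indicator of one
    interval, whose ends are the two columns sought. *)
Lemma interlaced_tri n A B x y :
  rep n A x -> rep n B y -> (forall k, A k <= B k <= A k + 1) ->
  is_fixed x -> is_fixed y -> peaked x -> peaked y -> x <> y -> tri x y.
Proof.
  intros RA RB AB Fx Fy Px Py ne.
  destruct (rep_common _ _ _ _ _ RA RB) as [b [b0 Hb]].
  assert (dx := proj1 RA); assert (dy := proj1 RB).
  set (F := fun k => B k - A k).
  assert (dF : forall k, F k = F (k - 1) + Z.of_nat (y k) - Z.of_nat (x k)).
  { intro k; unfold F; rewrite (dx k), (dy k); lia. }
  assert (F01 : forall k, F k = 0 \/ F k = 1).
  { intro k; unfold F; specialize (AB k); lia. }
  assert (Fend : forall k, k < - b \/ b < k -> F k = 0).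
  { intros k Hk; unfold F; destruct (Hb k); lia. }
  assert (ex : exists k, F k = 1).
  { apply NNPP; intro N; apply ne, functional_extensionality; intro k.
    assert (F0 : forall k, F k = 0).
    { intro l; destruct (F01 l) as [|Fl]; [assumption|].
      exfalso; apply N; exists l; exact Fl. }
    assert (E := dF k); rewrite !F0 in E; lia. }
  destruct ex as [k Fk].
  destruct (increase_point F (Z.min k (- b - 1)) k ltac:(lia)) as [i [Hi Li]].
  { rewrite Fend by lia; lia. }
  destruct (decrease_point F k (Z.max k (b + 1)) ltac:(lia)) as [j [Hj Lj]].
  { rewrite (Fend (Z.max k (b + 1))) by lia; lia. }
  assert (Ei := dF i); assert (Ej := dF j).
  assert (Fi := F01 i); assert (Fi' := F01 (i - 1)).
  assert (Fj := F01 j); assert (Fj' := F01 (j - 1)).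
  exists i, j; split; [lia|]; split; [lia|]; split; [lia|].
  intros m mi mj.
  assert (Em := dF m); assert (Fm := F01 m); assert (Fm' := F01 (m - 1)).
  destruct (Nat.lt_trichotomy (x m) (y m)) as [L|[L|L]]; [exfalso|exact L|exfalso].
  (* Two rises of a 0/1 function are separated by a fall [e]. *)
  - destruct (Z.lt_total m i) as [C|[C|C]]; [|lia|].
    + destruct (decrease_point F m (i - 1) ltac:(lia) ltac:(lia)) as [e [He Le]].
      assert (Ee := dF e).
      apply (no_double_crossing x y m e i Fx Py); lia.
    + destruct (decrease_point F i (m - 1)) as [e [He Le]]; [lia|lia|].
      assert (Ee := dF e).
      apply (no_double_crossing x y i e m Fx Py); lia.
  - destruct (Z.lt_total m j) as [C|[C|C]]; [|lia|].
    + destruct (increase_point F m (j - 1) ltac:(lia) ltac:(lia)) as [e [He Le]].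
      assert (Ee := dF e).
      apply (no_double_crossing y x m e j Fy Px); lia.
    + destruct (increase_point F j (m - 1) ltac:(lia) ltac:(lia)) as [e [He Le]].
      assert (Ee := dF e).
      apply (no_double_crossing y x j e m Fy Px); lia.
Qed.

(** [F] first leaves 0 upwards, at [d]. Were it negative at [k], it would have fallen between [d]
    and [k] and would have to rise again to end at 0: a double crossing. *)
Lemma lex_lt_sum_le n A B x y : rep n A x -> rep n B y ->
  is_fixed x -> peaked y -> lex_lt x y -> forall k, A k <= B k.
Proof.
  intros RA RB Fx Py [d [Hd Ld]] k.
  destruct (rep_common _ _ _ _ _ RA RB) as [b [b0 Hb]].
  assert (dx := proj1 RA); assert (dy := proj1 RB).
  set (F := fun k => B k - A k).
  assert (dF : forall k, F k = F (k - 1) + Z.of_nat (y k) - Z.of_nat (x k)).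
  { intro l; unfold F; rewrite (dx l), (dy l); lia. }
  assert (Fend : forall k, k < - b \/ b < k -> F k = 0).
  { intros l Hl; unfold F; destruct (Hb l); lia. }
  enough (0 <= F k) by (unfold F in *; lia).
  assert (low : forall l, l < d -> 0 <= F l).
  { intros l ld.
    rewrite <- (Fend (Z.min l (- b - 1))) by lia.
    apply monotone_le; [|lia]; intros j Hj; assert (E := dF j).
    rewrite (Hd j ltac:(lia)) in E; lia. }
  apply Z.nlt_ge; intro N.
  assert (0 <= F (d - 1)) by (apply low; lia).
  assert (Ed := dF d).
  assert (d < k).
  { apply Z.nle_gt; intro; assert (k < d \/ k = d) as [C| ->] by lia;
      [specialize (low k C)|]; lia. }
  destruct (decrease_point F d k ltac:(lia) ltac:(lia)) as [e [He Le]].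
  destruct (increase_point F k (Z.max k (b + 1)) ltac:(lia)) as [j [Hj Lj]].
  { rewrite (Fend (Z.max k (b + 1))) by lia; lia. }
  assert (Ee := dF e); assert (Ej := dF j).
  apply (no_double_crossing x y d e j Fx Py); lia.
Qed.

(** * Pyramids and adjacency of interlaced stable configurations *)

Definition pyramid (m h : Z) : config := fun k => Z.to_nat (h - Z.abs (k - m)).

(* Two interlaced stable configurations may still have a pyramid between them,
   when the first has lost the apex grain of the pyramid to the right and the
   second has lost it to the left; [good] excludes this. *)
Definition good (n : nat) (A B : Z -> Z) : Prop :=
  forall m h P, rep n P (pyramid m h) -> ~ (A m < P m /\ P (m - 1) < B (m - 1)).

(** The grain added at [j] keeps [m] on the left side of the split of [a]. Since [a] has lost a
    grain at [m], its left inequalities force unit descent of [x] left of [m], and the slope bound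
    makes this exact. Symmetrically, [b] controls the right flank. *)
Lemma tri_pair_pyramid a x b i m j :
  i < m < j -> is_fixed x -> peaked a -> peaked b ->
  (forall k, Z.of_nat (a k) = Z.of_nat (x k) -
     (if Z.eqb k m then 1 else 0) + (if Z.eqb k j then 1 else 0)) ->
  (forall k, Z.of_nat (b k) = Z.of_nat (x k) +
     (if Z.eqb k i then 1 else 0) - (if Z.eqb k m then 1 else 0)) ->
  x = pyramid m (Z.of_nat (x m)).
Proof.
  intros H Fx [pa [aR aL]] [pb [bR bL]] Ha Hb.
  assert (am := Ha m); assert (aj := Ha j); assert (bi := Hb i); assert (bm := Hb m).
  rewrite Z.eqb_refl in am, aj, bi, bm.
  destruct (Z.eqb_spec m j); [lia|]; destruct (Z.eqb_spec j m); [lia|].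
  destruct (Z.eqb_spec i m); [lia|]; destruct (Z.eqb_spec m i); [lia|].
  assert (mpa : m <= pa).
  { apply Z.nlt_ge; intro C; assert (E := aR m j ltac:(lia)).
    assert (G := fixed_slope x Fx m j ltac:(lia)); lia. }
  assert (mpb : pb < m).
  { apply Z.nle_gt; intro C; assert (E := bL m i ltac:(lia)).
    assert (G := fixed_slope x Fx i m ltac:(lia)); lia. }
  apply functional_extensionality; intro k; unfold pyramid.
  destruct (Z.lt_total k m) as [C|[->|C]].
  - assert (E := aL m k ltac:(lia)); assert (ak := Ha k).
    destruct (Z.eqb_spec k m); [lia|]; destruct (Z.eqb_spec k j); [lia|].
    assert (G := fixed_slope x Fx k m ltac:(lia)); lia.
  - lia.
  - assert (E := bR m k ltac:(lia)); assert (bk := Hb k).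
    destruct (Z.eqb_spec k m); [lia|]; destruct (Z.eqb_spec k i); [lia|].
    assert (G := fixed_slope x Fx m k ltac:(lia)); lia.
Qed.

Lemma lex_lt_irrefl x : ~ lex_lt x x.
Proof. intros [i [_ H]]; lia. Qed.

Lemma lex_lt_trans x y z : lex_lt x y -> lex_lt y z -> lex_lt x z.
Proof.
  intros [i [Hi Li]] [j [Hj Lj]]; exists (Z.min i j); split.
  - intros k Hk; rewrite Hi, Hj by lia; reflexivity.
  - destruct (Z.lt_total i j) as [C|[->|C]].
    + rewrite Z.min_l by lia; rewrite <- Hj by lia; exact Li.
    + rewrite Z.min_id; lia.
    + rewrite Z.min_r by lia; rewrite Hi by lia; exact Lj.
Qed.

(** Signed indicators allow two exchanges to be composed by addition. *)
Lemma tri_spec x y : tri x y -> exists i j, i < j /\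
  forall k, Z.of_nat (y k) = Z.of_nat (x k) +
     (if Z.eqb k i then 1 else 0) - (if Z.eqb k j then 1 else 0).
Proof.
  intros [i [j [ij [Hi [Hj H]]]]]; exists i, j; split; [exact ij|].
  intro k; destruct (Z.eqb_spec k i), (Z.eqb_spec k j); subst; try lia.
  rewrite (H k) by assumption; lia.
Qed.

(** The prefix sums of [z] are squeezed between [A] and [B], so [x], [z] and [y] differ pairwise by
    one grain; comparing the three exchanges leaves two configurations of columns. *)
Lemma interlaced_adjacent n A B x y z :
  rep n A x -> rep n B y -> (forall k, A k <= B k <= A k + 1) -> good n A B ->
  is_fixed x -> is_fixed y -> peaked x -> peaked y ->
  (exists C, rep n C z) -> is_fixed z -> peaked z ->
  lex_lt x z -> lex_lt z y -> False.
Proof.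
  intros RA RB AB GAB Fx Fy Px Py [C RC] Fz Pz xz zy.
  assert (AC := lex_lt_sum_le _ _ _ _ _ RA RC Fx Pz xz).
  assert (CB := lex_lt_sum_le _ _ _ _ _ RC RB Fz Py zy).
  assert (Txz : tri x z).
  { apply (interlaced_tri n A C); auto.
    - intro k; specialize (AB k); specialize (CB k); specialize (AC k); lia.
    - intros ->; exact (lex_lt_irrefl _ xz). }
  assert (Tzy : tri z y).
  { apply (interlaced_tri n C B); auto.
    - intro k; specialize (AB k); specialize (CB k); specialize (AC k); lia.
    - intros ->; exact (lex_lt_irrefl _ zy). }
  assert (Txy : tri x y).
  { apply (interlaced_tri n A B); auto.
    intros ->; exact (lex_lt_irrefl _ (lex_lt_trans _ _ _ xz zy)). }
  destruct (tri_spec _ _ Txz) as [i1 [j1 [ij1 H1]]].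
  destruct (tri_spec _ _ Tzy) as [i2 [j2 [ij2 H2]]].
  destruct (tri_spec _ _ Txy) as [i [j [ij H]]].
  assert (S : forall k, (if Z.eqb k i then 1 else 0) - (if Z.eqb k j then 1 else 0) =
    (if Z.eqb k i1 then 1 else 0) - (if Z.eqb k j1 then 1 else 0) +
    (if Z.eqb k i2 then 1 else 0) - (if Z.eqb k j2 then 1 else 0)).
  { intro k; specialize (H k); specialize (H1 k); specialize (H2 k); lia. }
  (* The composite has one gain and one loss, so a column gaining in one exchange loses in the
     other. *)
  assert (cases : (i2 = j1 /\ i = i1 /\ j = j2) \/ (i1 = j2 /\ i = i2 /\ j = j1)).
  { destruct (Z.eq_dec i2 j1) as [->|n1]; [|destruct (Z.eq_dec i1 j2) as [->|n2]].
    - left; assert (S1 := S i1); assert (S2 := S j2); clear - S1 S2 ij ij1 ij2.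
      rewrite Z.eqb_refl in S1, S2.
      rewrite (proj2 (Z.eqb_neq i1 j1)), (proj2 (Z.eqb_neq i1 j2)) in S1 by lia.
      rewrite (proj2 (Z.eqb_neq j2 j1)), (proj2 (Z.eqb_neq j2 i1)) in S2 by lia.
      destruct (Z.eqb_spec i1 i), (Z.eqb_spec i1 j), (Z.eqb_spec j2 i),
        (Z.eqb_spec j2 j); lia.
    - right; assert (S1 := S i2); assert (S2 := S j1); clear - S1 S2 ij ij1 ij2.
      rewrite Z.eqb_refl in S1, S2.
      rewrite (proj2 (Z.eqb_neq i2 j1)), (proj2 (Z.eqb_neq i2 j2)) in S1 by lia.
      rewrite (proj2 (Z.eqb_neq j1 j2)), (proj2 (Z.eqb_neq j1 i2)) in S2 by lia.
      destruct (Z.eqb_spec i2 i), (Z.eqb_spec i2 j), (Z.eqb_spec j1 i),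
        (Z.eqb_spec j1 j); lia.
    - exfalso; assert (S1 := S i1); assert (S2 := S i2); clear - S1 S2 ij ij1 ij2 n1 n2.
      rewrite Z.eqb_refl in S1, S2.
      rewrite (proj2 (Z.eqb_neq i1 j1)), (proj2 (Z.eqb_neq i1 j2)) in S1 by lia.
      rewrite (proj2 (Z.eqb_neq i2 j1)), (proj2 (Z.eqb_neq i2 j2)) in S2 by lia.
      destruct (Z.eqb_spec i1 i2), (Z.eqb_spec i2 i1), (Z.eqb_spec i1 i),
        (Z.eqb_spec i2 i), (Z.eqb_spec i1 j), (Z.eqb_spec i2 j); lia. }
  destruct cases as [[-> [-> ->]]|[-> [-> ->]]].
  (* Here [z] dips at [j1] between the raised columns [i1] and [j2], which contradicts peakedness on
     whichever side of the split [j1] lies. *)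
  - destruct Pz as [p [HR HL]].
    assert (h1 := H1 i1); assert (h2 := H1 j1); assert (h3 := H2 j2);
      assert (h4 := H2 j1).
    rewrite !Z.eqb_refl in *.
    destruct (Z.eqb_spec i1 j1); [lia|]; destruct (Z.eqb_spec j1 i1); [lia|].
    destruct (Z.eqb_spec j2 j1); [lia|]; destruct (Z.eqb_spec j1 j2); [lia|].
    destruct (Z.le_gt_cases j1 p) as [jp|jp].
    + assert (E := HL j1 i1 ltac:(lia)).
      assert (G := fixed_slope x Fx i1 j1 ltac:(lia)); lia.
    + assert (E := HR j1 j2 ltac:(lia)).
      assert (G := fixed_slope y Fy j1 j2 ltac:(lia)); lia.
  (* Here [x] and [y] arise from [z] by taking a grain off column [j2] to the right and to the
     left. *)
  - assert (E : z = pyramid j2 (Z.of_nat (z j2))).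
    { apply (tri_pair_pyramid x z y i2 j2 j1); auto.
      intro k; specialize (H1 k); lia. }
    rewrite E in RC; apply (GAB _ _ _ RC).
    rewrite <- E in RC.
    assert (dA := proj1 RA); assert (dB := proj1 RB); assert (dC := proj1 RC).
    assert (a1 := dA j2); assert (b1 := dB j2); assert (c1 := dC j2).
    assert (h1 := H1 j2); assert (h2 := H2 j2).
    rewrite !Z.eqb_refl in *.
    destruct (Z.eqb_spec j2 j1); [lia|]; destruct (Z.eqb_spec j2 i2); [lia|].
    assert (u1 := AC j2); assert (u2 := AC (j2 - 1)).
    assert (v1 := CB j2); assert (v2 := CB (j2 - 1)).
    assert (w1 := AB j2); assert (w2 := AB (j2 - 1)); lia.
Qed.

(** * Interlaced trajectories *)

(** Column [m + 1] has height at most [h - 2], and peakedness keeps all later columns below the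
    pyramid. With equal totals, fewer grains beyond [m] means more up to [m]. *)
Lemma right_deficit n A x P m h :
  rep n A x -> peaked x -> rep n P (pyramid m h) ->
  (x (m + 1)%Z + 2 <= x m)%nat -> Z.of_nat (x m) <= h -> P m < A m.
Proof.
  intros RA [p [HR HL]] RP D xm.
  destruct (rep_common _ _ _ _ _ RA RP) as [b [b0 Hb]].
  assert (dA := proj1 RA); assert (dP := proj1 RP).
  assert (pm : p <= m).
  { apply Z.nlt_ge; intro C; assert (E := HL (m + 1) m ltac:(lia)); lia. }
  assert (E : P (m + 1) <= A (m + 1)).
  { assert (G := antitone_le (fun k => A k - P k) (m + 1) (Z.max (m + 1) (b + 1))).
    cbn beta in G; destruct (Hb (Z.max (m + 1) (b + 1))) as [_ Hr].
    specialize (Hr ltac:(lia)).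
    enough (A (Z.max (m + 1) (b + 1)) - P (Z.max (m + 1) (b + 1)) <= A (m + 1) - P (m + 1))
      by lia.
    apply G; [|lia]; intros k Hk; rewrite (dA k), (dP k).
    assert (E := HR (m + 1) k ltac:(lia)); unfold pyramid; lia. }
  assert (a1 := dA (m + 1)); assert (p1 := dP (m + 1)).
  replace (m + 1 - 1) with m in * by lia.
  unfold pyramid in p1; lia.
Qed.

(** Mirror image: the columns up to [m - 1] hold fewer grains than those of the pyramid. *)
Lemma left_deficit n A x P m h :
  rep n A x -> peaked x -> rep n P (pyramid m h) ->
  (x (m - 1)%Z + 2 <= x m)%nat -> Z.of_nat (x m) <= h -> A (m - 1) < P (m - 1).
Proof.
  intros RA [p [HR HL]] RP D xm.
  destruct (rep_common _ _ _ _ _ RA RP) as [b [b0 Hb]].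
  assert (dA := proj1 RA); assert (dP := proj1 RP).
  assert (pm : m <= p + 1).
  { apply Z.nlt_ge; intro C; assert (E := HR (m - 1) m ltac:(lia)); lia. }
  assert (E : A (m - 2) <= P (m - 2)).
  { assert (G := antitone_le (fun k => A k - P k) (Z.min (m - 2) (- b - 1)) (m - 2)).
    cbn beta in G; destruct (Hb (Z.min (m - 2) (- b - 1))) as [Hl _].
    specialize (Hl ltac:(lia)).
    enough (A (m - 2) - P (m - 2) <=
      A (Z.min (m - 2) (- b - 1)) - P (Z.min (m - 2) (- b - 1))) by lia.
    apply G; [|lia]; intros k Hk; rewrite (dA k), (dP k).
    assert (E := HL (m - 1) k ltac:(lia)); unfold pyramid; lia. }
  assert (a1 := dA (m - 1)); assert (p1 := dP (m - 1)).
  replace (m - 1 - 1) with (m - 2) in * by lia.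
  unfold pyramid in p1; lia.
Qed.

Definition interlaced (A B : Z -> Z) : Prop := forall k, A k <= B k <= A k + 1.

(* To break [good], one of the two sides has to move a grain out of column [m]
   when it has height at most [h]; the deficit lemmas forbid this. *)
Lemma good_flow n A B x y f g x' y' :
  rep n A x -> rep n B y -> peaked x -> peaked y ->
  flow x f x' -> flow y g y' -> good n A B ->
  interlaced (flow_sum A f) (flow_sum B g) ->
  good n (flow_sum A f) (flow_sum B g).
Proof.
  intros RA RB Px Py Fx Fy G I m h P RP [HA HB].
  assert (I1 := I m); assert (I2 := I (m - 1)).
  assert (dP := proj1 RP m).
  assert (hm : Z.of_nat (pyramid m h m) = Z.max 0 h) by (unfold pyramid; lia).
  unfold flow_sum in *.
  assert (Rf := flow_range _ _ _ Fx); assert (Rg := flow_range _ _ _ Fy).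
  assert (dA := proj1 RA m); assert (dB := proj1 RB m).
  specialize (Rf m) as Rf1; specialize (Rf (m - 1)).
  specialize (Rg m) as Rg1; specialize (Rg (m - 1)).
  destruct (Z.lt_ge_cases (A m) (P m)) as [C|C];
    [destruct (Z.lt_ge_cases (P (m - 1)) (B (m - 1))) as [C'|C']|].
  - exact (G m h P RP (conj C C')).
  (* Now [B (m - 1) = P (m - 1)]. Interlacing after the step, with [g m <= 0], gives [B m <= P m],
     hence the height bound for [left_deficit]. *)
  - assert (g1 : g (m - 1) = -1) by lia.
    assert (O := flow_once _ _ _ Fy m g1).
    assert (D := flow_left _ _ _ Fy (m - 1) g1).
    replace (m - 1 + 1) with m in D by lia.
    assert (E := left_deficit n B y P m h RB Py RP D).
    lia.
  - assert (f1 : f m = 1) by lia.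
    assert (O : f (m - 1) <> -1) by (intro O; exact (flow_once _ _ _ Fx m O f1)).
    assert (D := flow_right _ _ _ Fx m f1).
    assert (E := right_deficit n A x P m h RA Px RP D).
    lia.
Qed.

(** * Parallel steps as flows *)

Definition canL (c : config) (k : Z) : bool := Nat.leb (c (k - 1)%Z + 2) (c k).
Definition canR (c : config) (k : Z) : bool := Nat.leb (c (k + 1)%Z + 2) (c k).

Definition choose (c : config) (pref : Z -> bool) (k : Z) : option rule :=
  match canL c k, canR c k with
  | true, true => if pref k then Some RuleL else Some RuleR
  | true, false => Some RuleL
  | false, true => Some RuleR
  | false, false => None
  end.

Definition next (c : config) (pref : Z -> bool) : config :=
  apply_choice c (choose c pref).

Definition choice_flow (ch : Z -> option rule) (k : Z) : Z :=
  Z.of_nat (firesR (ch k)) - Z.of_nat (firesL (ch (k + 1))).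

Definition next_flow (c : config) (pref : Z -> bool) : Z -> Z :=
  choice_flow (choose c pref).

Lemma choose_valid c pref : valid_choice c (choose c pref).
Proof.
  intro k; unfold choose, canL, canR, L_applicable, R_applicable.
  destruct (Nat.leb_spec (c (k - 1) + 2) (c k)), (Nat.leb_spec (c (k + 1) + 2) (c k));
    try destruct (pref k); lia.
Qed.

Lemma next_step c pref : psspm_step c (next c pref).
Proof. exists (choose c pref); split; [apply choose_valid|reflexivity]. Qed.

Lemma choice_flowP c ch : valid_choice c ch ->
  flow c (choice_flow ch) (apply_choice c ch).
Proof.
  intro V; unfold valid_choice, L_applicable, R_applicable in V.
  assert (V1 : forall k, ch k = Some RuleL -> (c (k - 1)%Z + 2 <= c k)%nat).
  { intros k E; specialize (V k); rewrite E in V; exact V. }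
  assert (V2 : forall k, ch k = Some RuleR -> (c (k + 1)%Z + 2 <= c k)%nat).
  { intros k E; specialize (V k); rewrite E in V; exact V. }
  unfold choice_flow; split; intro k.
  - destruct (ch k) as [[]|], (ch (k + 1)) as [[]|]; cbn; lia.
  - specialize (V2 k).
    destruct (ch k) as [[]|], (ch (k + 1)) as [[]|]; cbn; try lia; intros; apply V2;
      reflexivity.
  - specialize (V1 (k + 1)); replace (k + 1 - 1) with k in V1 by lia.
    destruct (ch k) as [[]|], (ch (k + 1)) as [[]|]; cbn; try lia; intros; apply V1;
      reflexivity.
  - replace (k - 1 + 1) with k by lia.
    destruct (ch k) as [[]|], (ch (k - 1)) as [[]|], (ch (k + 1)) as [[]|]; cbn; lia.
  - unfold apply_choice; replace (k - 1 + 1) with k by lia.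
    (* A firing column has at least two grains, so the natural subtraction in [apply_choice] does
       not truncate. *)
    specialize (V1 k); specialize (V2 k).
    destruct (ch k) as [[]|]; [specialize (V1 eq_refl)|specialize (V2 eq_refl)|];
      destruct (ch (k - 1)) as [[]|], (ch (k + 1)) as [[]|]; cbn; lia.
Qed.

Lemma next_flowP c pref : flow c (next_flow c pref) (next c pref).
Proof. apply choice_flowP, choose_valid. Qed.

(** A column exceeding both neighbours by two must be adjacent to the split edge, and its two end
    columns cannot each exceed the other. *)
Lemma fork_unique c k l : peaked c ->
  canL c k = true -> canR c k = true -> canL c l = true -> canR c l = true -> k = l.
Proof.
  unfold canL, canR; intros [p [HR HL]] k1 k2 l1 l2.
  apply Nat.leb_le in k1, k2, l1, l2.
  assert (B : forall q, (c (q - 1)%Z + 2 <= c q)%nat -> (c (q + 1)%Z + 2 <= c q)%nat ->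
    q = p \/ q = p + 1).
  { intros q q1 q2.
    assert (p <= q).
    { apply Z.nlt_ge; intro C; assert (E := HL (q + 1) q ltac:(lia)); lia. }
    assert (q <= p + 1); [|lia].
    apply Z.nlt_ge; intro C; assert (E := HR (q - 1) q ltac:(lia)); lia. }
  destruct (B k k1 k2) as [-> | ->], (B l l1 l2) as [-> | ->]; try reflexivity;
    replace (p + 1 - 1) with p in * by lia; lia.
Qed.

(** With at most one fork, the only freedom is one Boolean, so constant preferences exhaust all
    steps. *)
Lemma psspm_step_next c c' : peaked c -> psspm_step c c' ->
  c' = next c (fun _ => true) \/ c' = next c (fun _ => false).
Proof.
  intros Pc [ch [V ->]].
  assert (E : forall b, (forall k, canL c k = true -> canR c k = true ->
      ch k = if b : bool then Some RuleL else Some RuleR) ->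
    apply_choice c ch = next c (fun _ => b)).
  { intros b H; unfold next; f_equal; apply functional_extensionality; intro k.
    specialize (V k); specialize (H k).
    unfold choose, canL, canR, L_applicable, R_applicable in *.
    destruct (Nat.leb_spec (c (k - 1) + 2) (c k)), (Nat.leb_spec (c (k + 1) + 2) (c k));
      auto; destruct (ch k) as [[]|]; lia || reflexivity. }
  destruct (classic (exists q, canL c q = true /\ canR c q = true)) as [[q [q1 q2]]|N].
  - assert (Vq := V q); destruct (ch q) as [[]|] eqn:Eq.
    + left; apply E; intros k k1 k2.
      rewrite (fork_unique c k q); assumption.
    + right; apply E; intros k k1 k2.
      rewrite (fork_unique c k q); assumption.
    + unfold canL, L_applicable in *; apply Nat.leb_le in q1; tauto.
  - left; apply E; intros k k1 k2; exfalso; apply N; exists k; split; assumption.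
Qed.

(** An edge can be crossed from one end only, so preferring left to right lowers its flow by at most
    one and never raises it. *)
Lemma fork_interlaced A c :
  interlaced (flow_sum A (next_flow c (fun _ => false)))
             (flow_sum A (next_flow c (fun _ => true))).
Proof.
  intro k; unfold flow_sum, next_flow, choice_flow, choose, canL, canR.
  replace (k + 1 - 1) with k by lia.
  destruct (Nat.leb_spec (c (k - 1) + 2) (c k)), (Nat.leb_spec (c (k + 1) + 2) (c k)),
    (Nat.leb_spec (c k + 2) (c (k + 1))), (Nat.leb_spec (c (k + 1 + 1) + 2) (c (k + 1)));
    cbn; lia.
Qed.

(* Columns free to go both ways imitate the other configuration; this is what
   keeps the prefix sums interlaced. *)
Definition imitate (c : config) (k : Z) : bool := canL c k && negb (canR c k).

(** The slope at edge [k] is a second difference. Where [A] and [B] agree at [k], [y] is pushed left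
    at least as strongly as [x]; where [B] is one ahead, the comparison reverses. Opposite flows
    would need slopes differing by four, but they differ by at most two. Only a fork could break the
    order, and it imitates the other side; two facing forks both go right. *)
Lemma next_interlaced n A B x y : rep n A x -> rep n B y -> interlaced A B ->
  interlaced (flow_sum A (next_flow x (imitate y)))
             (flow_sum B (next_flow y (imitate x))).
Proof.
  intros RA RB I k.
  assert (a1 := proj1 RA k); assert (a2 := proj1 RA (k + 1)).
  assert (b1 := proj1 RB k); assert (b2 := proj1 RB (k + 1)).
  assert (I1 := I (k - 1)); assert (I2 := I k); assert (I3 := I (k + 1)).
  unfold flow_sum, next_flow, choice_flow, choose, imitate, canL, canR.
  replace (k + 1 - 1) with k in * by lia.
  clear I RA RB.
  destruct (Nat.leb_spec (x (k + 1) + 2) (x k)), (Nat.leb_spec (x k + 2) (x (k + 1)));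
    try lia;
  destruct (Nat.leb_spec (y (k + 1) + 2) (y k)), (Nat.leb_spec (y k + 2) (y (k + 1)));
    try lia;
  destruct (Nat.leb_spec (x (k - 1) + 2) (x k)), (Nat.leb_spec (y (k - 1) + 2) (y k)),
    (Nat.leb_spec (x (k + 1 + 1) + 2) (x (k + 1))),
    (Nat.leb_spec (y (k + 1 + 1) + 2) (y (k + 1)));
    cbn; lia.
Qed.

(** The relation is directed: the second configuration has its grains further left. *)
Definition near (n : nat) (x y : config) : Prop :=
  exists A B, rep n A x /\ rep n B y /\ interlaced A B /\ good n A B.

(** By uniqueness of prefix sums, [near n x x] says that they exist and are [good] against
    themselves. *)
Definition tame (n : nat) (x : config) : Prop := peaked x /\ near n x x.

Lemma near_next n x y : peaked x -> peaked y -> near n x y ->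
  near n (next x (imitate y)) (next y (imitate x)).
Proof.
  intros Px Py [A [B [RA [RB [I G]]]]].
  exists (flow_sum A (next_flow x (imitate y))), (flow_sum B (next_flow y (imitate x))).
  assert (Fx := next_flowP x (imitate y)); assert (Fy := next_flowP y (imitate x)).
  assert (I' := next_interlaced _ _ _ _ _ RA RB I).
  repeat split; try (apply I'); try (eapply rep_flow; eassumption).
  eapply good_flow with (x := x) (y := y); eassumption.
Qed.

Lemma near_self n x : near n x x -> exists A, rep n A x /\ good n A A.
Proof.
  intros [A [B [RA [RB [_ G]]]]]; exists A; split; [exact RA|].
  intros m h P RP; rewrite (rep_unique _ _ _ _ RA RB (m - 1)) at 1; exact (G m h P RP).
Qed.

Lemma near_fork n x : tame n x ->
  near n (next x (fun _ => false)) (next x (fun _ => true)).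
Proof.
  intros [Px N]; destruct (near_self _ _ N) as [A [RA G]].
  exists (flow_sum A (next_flow x (fun _ => false))),
    (flow_sum A (next_flow x (fun _ => true))).
  assert (F1 := next_flowP x (fun _ => false)).
  assert (F2 := next_flowP x (fun _ => true)).
  assert (I := fork_interlaced A x).
  repeat split; try (apply I); try (eapply rep_flow; eassumption).
  eapply good_flow with (x := x) (y := x); eassumption.
Qed.

Lemma tame_single n : tame n (single n).
Proof.
  split; [apply peaked_single|].
  exists (single_sum n), (single_sum n); repeat split; try apply rep_single; try lia.
  intros m h P RP [H1 H2].
  (* As [P] lies between 0 and [n], the first inequality forces [m < 0] and the second [m >= 1]. *)
  assert (B1 := rep_bounds _ _ _ m RP); assert (B2 := rep_bounds _ _ _ (m - 1) RP).
  unfold single_sum in *.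
  destruct (Z.ltb_spec m 0), (Z.ltb_spec (m - 1) 0); lia.
Qed.

Lemma tame_step n x x' : tame n x -> psspm_step x x' -> tame n x'.
Proof.
  intros [Px N] [ch [V ->]]; destruct (near_self _ _ N) as [A [RA G]].
  assert (F := choice_flowP x ch V).
  split; [eapply peaked_flow; eassumption|].
  exists (flow_sum A (choice_flow ch)), (flow_sum A (choice_flow ch)).
  repeat split; try (eapply rep_flow; eassumption); try lia.
  eapply good_flow with (x := x) (y := x); try eassumption.
  intro k; lia.
Qed.

(** A single move is a flow on one edge, so sequential configurations inherit peakedness from the
    same lemmas. *)
Lemma sspm_step_flow c c' : sspm_step c c' -> exists f, flow c f c'.
Proof.
  unfold sspm_step, L_applicable, R_applicable; intros [i [[H ->]|[H ->]]].
  - exists (fun k => if Z.eqb k (i - 1) then -1 else 0); split; intro k; unfold moveL; cbn beta.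
    + destruct (Z.eqb_spec k (i - 1)); lia.
    + destruct (Z.eqb_spec k (i - 1)); lia.
    + destruct (Z.eqb_spec k (i - 1)) as [->|]; [|lia].
      replace (i - 1 + 1) with i by lia; intros _; exact H.
    + destruct (Z.eqb_spec k (i - 1)); lia.
    + destruct (Z.eqb_spec k i), (Z.eqb_spec k (i - 1)), (Z.eqb_spec (k - 1) (i - 1));
        subst; lia.
  - exists (fun k => if Z.eqb k i then 1 else 0); split; intro k; unfold moveR; cbn beta.
    + destruct (Z.eqb_spec k i); lia.
    + destruct (Z.eqb_spec k i) as [->|]; lia.
    + destruct (Z.eqb_spec k i); lia.
    + destruct (Z.eqb_spec (k - 1) i); lia.
    + destruct (Z.eqb_spec k i), (Z.eqb_spec k (i + 1)), (Z.eqb_spec (k - 1) i);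
        subst; lia.
Qed.

Lemma sspm_reachable_peaked n c : reachable sspm_step n c ->
  peaked c /\ exists A, rep n A c.
Proof.
  induction 1 as [|c c' _ [Pc [A RA]] St].
  - split; [apply peaked_single|exists (single_sum n); apply rep_single].
  - destruct (sspm_step_flow _ _ St) as [f F]; split.
    + eapply peaked_flow; eassumption.
    + exists (flow_sum A f); eapply rep_flow; eassumption.
Qed.

(** * Levels and termination *)

(** Time is explicit because connectedness compares configurations of equal age. *)
Fixpoint level (n t : nat) (c : config) : Prop :=
  match t with
  | O => c = single n
  | S t => exists b, level n t b /\ psspm_step b c
  end.

Lemma level_tame n t c : level n t c -> tame n c.
Proof.
  revert c; induction t as [|t IH]; cbn.
  - intros c ->; apply tame_single.
  - intros c [b [Lb St]]; eapply tame_step; eauto.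
Qed.

Lemma level_finite n t : exists l, forall c, In c l <-> level n t c.
Proof.
  induction t as [|t [l Hl]].
  - exists (single n :: nil); intro c; cbn; split; [intros [<-|[]]|intros ->]; auto.
  - exists (flat_map
      (fun c => next c (fun _ => true) :: next c (fun _ => false) :: nil) l).
    intro c; rewrite in_flat_map; cbn; split.
    + intros [b [Hb [<-|[<-|[]]]]]; exists b; split;
        try apply Hl; auto; apply next_step.
    + intros [b [Hb St]]; exists b; split; [apply Hl, Hb|].
      destruct (psspm_step_next b c) as [-> | ->]; auto.
      apply (level_tame n t b Hb).
Qed.

Definition link (n t : nat) (x y : config) : Prop :=
  level n t x /\ level n t y /\ (near n x y \/ near n y x).

Lemma link_successors n t x x' y' : level n t x ->
  psspm_step x x' -> psspm_step x y' -> link n (S t) x' y'.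
Proof.
  intros Lx Sx Sy; assert (Tx := level_tame _ _ _ Lx).
  split; [exists x; auto|]; split; [exists x; auto|].
  assert (Fk := near_fork _ _ Tx).
  destruct (psspm_step_next x x' (proj1 Tx) Sx) as [-> | ->],
    (psspm_step_next x y' (proj1 Tx) Sy) as [-> | ->]; auto; left;
    exact (proj2 (tame_step n x _ Tx Sx)).
Qed.

(** A path at time [t] lifts to time [t + 1]: each link from [x] to [z] becomes the link between
    their imitating successors, and different successors of one configuration are joined by
    [link_successors]. *)
Lemma level_connected n t x y : level n t x -> level n t y ->
  clos_refl_trans_1n _ (link n t) x y.
Proof.
  revert x y; induction t as [|t IH]; cbn.
  - intros x y -> ->; constructor.
  - intros x' y' [x [Lx Sx]] [y [Ly Sy]].
    specialize (IH x y Lx Ly); revert x' Lx Sx.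
    induction IH as [x|x z y [_ [Lz N]] _ IHz]; intros x' Lx Sx.
    + econstructor; [apply (link_successors n t x)|constructor]; auto.
    + apply Relation_Operators.rt1n_trans with (y := next x (imitate z)).
      { apply (link_successors n t x); auto; apply next_step. }
      apply Relation_Operators.rt1n_trans with (y := next z (imitate x)).
      { split; [exists x; split; [exact Lx|apply next_step]|].
        split; [exists z; split; [exact Lz|apply next_step]|].
        destruct (level_tame _ _ _ Lx), (level_tame _ _ _ Lz).
        destruct N; [left|right]; apply near_next; assumption. }
      apply IHz; auto; apply next_step.
Qed.

Lemma clos_cut (T : Type) (R : T -> T -> Prop) (Q : T -> Prop) u v :
  clos_refl_trans_1n T R u v -> Q u -> ~ Q v ->
  exists y z, R y z /\ Q y /\ ~ Q z.
Proof.
  induction 1 as [x|x y z Rxy _ IH]; intros Qx Qz; [contradiction|].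
  destruct (classic (Q y)) as [Qy|Qy]; [auto|exists x, y; auto].
Qed.

(** * Stabilisation by a quadratic energy *)

Fixpoint energy (x : config) (a : Z) (l : nat) : Z :=
  match l with
  | O => 0
  | S l => energy x a l + Z.of_nat (x (a + Z.of_nat l)) ^ 2
  end.

(** The shift by one assigns to each column of the window the edge on its left. *)
Fixpoint crossings (f : Z -> Z) (a : Z) (l : nat) : Z :=
  match l with
  | O => 0
  | S l => crossings f a l + Z.abs (f (a + Z.of_nat l - 1))
  end.

(* Summation by parts: each grain crossing an edge lowers the energy. *)
Lemma energy_flow x f x' a l : flow x f x' -> f (a - 1) = 0 ->
  energy x' a l + crossings f a l +
    (Z.of_nat (x (a + Z.of_nat l - 1)) + Z.of_nat (x' (a + Z.of_nat l - 1))) *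
      f (a + Z.of_nat l - 1)
  <= energy x a l.
Proof.
  intros F fa; induction l as [|l IH].
  - cbn [energy crossings]; replace (a + Z.of_nat 0 - 1) with (a - 1) by lia; lia.
  - cbn [energy crossings].
    replace (a + Z.of_nat (S l) - 1) with (a + Z.of_nat l) by lia.
    set (k := a + Z.of_nat l) in *.
    assert (U := flow_upd _ _ _ F k).
    assert (U' := flow_upd _ _ _ F (k - 1)).
    assert (Rk := flow_range _ _ _ F k).
    assert (R := flow_range _ _ _ F (k - 1)).
    assert (R' := flow_range _ _ _ F (k - 1 - 1)).
    assert (D1 := flow_right _ _ _ F (k - 1)).
    assert (D2 := flow_left _ _ _ F (k - 1)).
    assert (O1 := flow_once _ _ _ F (k - 1)).
    assert (O2 := flow_once _ _ _ F k).
    replace (k - 1 + 1) with k in * by lia.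
    set (u := Z.of_nat (x k)) in *; set (u' := Z.of_nat (x' k)) in *.
    set (v := Z.of_nat (x (k - 1))) in *; set (v' := Z.of_nat (x' (k - 1))) in *.
    assert (E : u' ^ 2 - u ^ 2 + (u + u') * f k = f (k - 1) * (u + u')).
    { rewrite U; ring. }
    (* The sending column loses at most one grain net and the receiver gains at most two; a drop of
       two thus keeps the sum of old and new heights larger on the sending side. *)
    assert (f (k - 1) * (u + u') + Z.abs (f (k - 1)) <= (v + v') * f (k - 1)).
    { assert (f (k - 1) = 0 \/ f (k - 1) = 1 \/ f (k - 1) = -1) as [e|[e|e]] by lia;
        rewrite e in *; lia. }
    lia.
Qed.

Lemma crossings_nonneg f a l : 0 <= crossings f a l.
Proof. induction l; cbn; lia. Qed.

Lemma crossings_pos f a l k : a <= k + 1 < a + Z.of_nat l -> f k <> 0 ->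
  1 <= crossings f a l.
Proof.
  intros H fk; induction l as [|l IH]; [lia|cbn [crossings]].
  destruct (Z.eq_dec (k + 1) (a + Z.of_nat l)) as [<-|ne].
  - replace (k + 1 - 1) with k by lia.
    assert (P := crossings_nonneg f a l); lia.
  - assert (E := IH ltac:(lia)); lia.
Qed.

Lemma energy_nonneg x a l : 0 <= energy x a l.
Proof. induction l; cbn [energy]; nia. Qed.

Lemma energy_single n a l : energy (single n) a l <= Z.of_nat n ^ 2.
Proof.
  (* The induction needs the exact value, which depends on whether the window contains column 0. *)
  enough (H : energy (single n) a l =
    if Z.ltb 0 (a + Z.of_nat l) then if Z.leb a 0 then Z.of_nat n ^ 2 else 0 else 0).
  { rewrite H; destruct (Z.ltb 0 (a + Z.of_nat l)), (Z.leb a 0); nia. }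
  induction l as [|l IH]; cbn [energy].
  - destruct (Z.ltb_spec 0 (a + Z.of_nat 0)), (Z.leb_spec a 0); lia.
  - rewrite IH; unfold single; destruct (Z.eqb_spec (a + Z.of_nat l) 0),
      (Z.ltb_spec 0 (a + Z.of_nat l)), (Z.leb_spec a 0),
      (Z.ltb_spec 0 (a + Z.of_nat (S l))); cbn [Z.of_nat]; lia.
Qed.

Lemma level_support n t c k : level n t c -> Z.of_nat t < Z.abs k -> c k = 0%nat.
Proof.
  revert c k; induction t as [|t IH]; cbn [level].
  - intros c k -> H; unfold single; destruct (Z.eqb_spec k 0); lia.
  - intros c k [b [Lb [ch [V ->]]]] H.
    assert (F := choice_flowP b ch V).
    assert (U := flow_upd _ _ _ F k).
    assert (R1 := flow_range _ _ _ F k); assert (R2 := flow_range _ _ _ F (k - 1)).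
    assert (D1 := flow_left _ _ _ F k); assert (D2 := flow_right _ _ _ F (k - 1)).
    assert (D3 := flow_left _ _ _ F (k - 1)); assert (D4 := flow_right _ _ _ F k).
    replace (k - 1 + 1) with k in * by lia.
    assert (b0 := IH b k Lb ltac:(lia)).
    assert (b1 := IH b (k - 1) Lb); assert (b2 := IH b (k + 1) Lb); lia.
Qed.

Lemma fixed_step c c' : is_fixed c -> psspm_step c c' -> c' = c.
Proof.
  intros Fc [ch [V ->]]; apply functional_extensionality; intro k.
  assert (N : forall j, ch j = None).
  { intro j; specialize (V j); destruct (Fc j).
    destruct (ch j) as [[]|]; [contradiction|contradiction|reflexivity]. }
  unfold apply_choice; rewrite !N; cbn; lia.
Qed.

(** Opposite grains never cross the same edge in a valid choice, so a firing rule cannot be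
    cancelled in the flow. *)
Lemma valid_choice_unfixed c ch : valid_choice c ch -> ~ is_fixed c ->
  exists k, choice_flow ch k <> 0.
Proof.
  intros V N; apply NNPP; intro E; apply N; intro i.
  assert (Z0 : forall k, choice_flow ch k = 0).
  { intro k; apply NNPP; intro; apply E; exists k; assumption. }
  assert (Vi := V i); destruct (ch i) as [[]|] eqn:Ei; [exfalso|exfalso|exact Vi].
  - assert (C := Z0 (i - 1)); unfold choice_flow in C.
    replace (i - 1 + 1) with i in C by lia; rewrite Ei in C.
    assert (Vj := V (i - 1)); destruct (ch (i - 1)) as [[]|]; cbn in C; try lia.
    unfold L_applicable, R_applicable in *.
    replace (i - 1 + 1) with i in Vj by lia; lia.
  - assert (C := Z0 i); unfold choice_flow in C; rewrite Ei in C.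
    assert (Vj := V (i + 1)); destruct (ch (i + 1)) as [[]|]; cbn in C; try lia.
    unfold L_applicable, R_applicable in *.
    replace (i + 1 - 1) with i in Vj by lia; lia.
Qed.

(** The window from [- w - 1] to [w + 1] contains every edge that can carry flow before time [w],
    and its boundary edges carry none. Each step from an unstable configuration costs at least one
    unit of energy. *)
Lemma level_energy n w t c : level n t c -> (t < w)%nat ->
  is_fixed c \/
  energy c (- Z.of_nat w - 1) (2 * w + 3) + Z.of_nat t <= Z.of_nat n ^ 2.
Proof.
  revert c; induction t as [|t IH].
  - intros c -> _; right; assert (E := energy_single n (- Z.of_nat w - 1) (2 * w + 3)).
    lia.
  - intros c Lc tw; assert (Lc' := Lc); cbn [level] in Lc'.
    destruct Lc' as [b [Lb St]].
    destruct (classic (is_fixed b)) as [Fb|Nb].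
    { left; rewrite (fixed_step b c); assumption. }
    destruct (IH b Lb ltac:(lia)) as [Fb|Eb]; [contradiction|right].
    destruct St as [ch [V ->]].
    assert (F := choice_flowP b ch V).
    destruct (valid_choice_unfixed b ch V Nb) as [k fk].
    assert (far : forall j, Z.of_nat w <= Z.abs j ->
      Z.of_nat w <= Z.abs (j + 1) -> choice_flow ch j = 0).
    { intros j j1 j2; assert (R := flow_range _ _ _ F j).
      assert (D1 := flow_left _ _ _ F j); assert (D2 := flow_right _ _ _ F j).
      assert (z1 := level_support n t b j Lb ltac:(lia)).
      assert (z2 := level_support n t b (j + 1) Lb ltac:(lia)); lia. }
    assert (E := energy_flow b (choice_flow ch) _ (- Z.of_nat w - 1) (2 * w + 3) F).
    rewrite far in E by lia; specialize (E eq_refl).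
    rewrite (far (- Z.of_nat w - 1 + Z.of_nat (2 * w + 3) - 1)) in E by lia.
    assert (P := crossings_pos (choice_flow ch) (- Z.of_nat w - 1) (2 * w + 3) k).
    assert (Z.abs k <= Z.of_nat w).
    { apply Z.nlt_ge; intro; apply fk, far; lia. }
    specialize (P ltac:(lia) fk); lia.
Qed.

Lemma level_fixed n c : level n (S (n * n)) c -> is_fixed c.
Proof.
  intro Lc; destruct (level_energy n (S (S (n * n))) _ c Lc) as [|E]; [lia|assumption|].
  assert (P := energy_nonneg c (- Z.of_nat (S (S (n * n))) - 1) (2 * S (S (n * n)) + 3)).
  nia.
Qed.

Lemma level_reachable n t c : level n t c -> reachable psspm_step n c.
Proof.
  revert c; induction t as [|t IH]; cbn [level].
  - intros c ->; constructor.
  - intros c [b [Lb St]]; econstructor; eauto.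
Qed.

Lemma fixed_level_mono n t c : level n t c -> is_fixed c ->
  forall s, (t <= s)%nat -> level n s c.
Proof.
  intros Lc Fc s ts; induction ts as [|s _ IH]; [exact Lc|].
  exists c; split; [exact IH|].
  rewrite <- (fixed_step c (next c (fun _ => true)) Fc (next_step _ _)) at 2.
  apply next_step.
Qed.

(** Fixed points persist under parallel steps, and at time [n * n + 1] everything is fixed, so this
    level collects both the earlier and the later ones. *)
Lemma PSSPM_fixed_level n c : PSSPM_fixed n c <-> level n (S (n * n)) c.
Proof.
  split.
  - intros [Rc Fc].
    assert (H : exists t, level n t c).
    { clear Fc; induction Rc as [|c c' _ [t Lc] St].
      - exists O; reflexivity.
      - exists (S t), c; auto. }
    destruct H as [t Lc].
    destruct (Nat.le_ge_cases t (S (n * n))) as [H|H].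
    { apply (fixed_level_mono n t c Lc Fc _ H). }
    clear Fc Rc; revert c Lc; induction H as [|t H IH]; intros c Lc; [exact Lc|].
    destruct Lc as [b [Lb St]]; assert (Lb' := IH b Lb).
    rewrite (fixed_step b c (level_fixed _ _ Lb') St); exact Lb'.
  - intro Lc; split; [eapply level_reachable; eassumption|exact (level_fixed n c Lc)].
Qed.

(** * Lexicographic listing *)

Lemma lex_total n A B x y : rep n A x -> rep n B y -> x <> y ->
  lex_lt x y \/ lex_lt y x.
Proof.
  intros RA RB ne.
  assert (ex : exists k, x k <> y k).
  { apply NNPP; intro N; apply ne, functional_extensionality; intro k.
    apply NNPP; intro; apply N; exists k; assumption. }
  destruct ex as [k Hk].
  destruct (rep_common _ _ _ _ _ RA RB) as [b [_ Hb]].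
  destruct (first_difference x y (- b) k) as [d [Hd Eq]]; [|exact Hk|].
  - intros j Hj; assert (a := proj1 RA j); assert (b' := proj1 RB j).
    destruct (Hb j) as [H1 _], (Hb (j - 1)) as [H2 _]; lia.
  - destruct (Nat.lt_total (x d) (y d)) as [L|[L|L]]; [left|contradiction|right];
      exists d; split; auto; intros j Hj; symmetry; auto.
Qed.

Fixpoint lex_sorted (l : list config) : Prop :=
  match l with
  | nil => True
  | x :: l' => (forall y, In y l' -> lex_lt x y) /\ lex_sorted l'
  end.

(** Comparability is assumed only against members of [l], since arbitrary configurations may have no
    first difference. *)
Lemma lex_insert x l :
  (forall y, In y l -> x <> y -> lex_lt x y \/ lex_lt y x) -> lex_sorted l ->
  exists l', lex_sorted l' /\ forall y, In y l' <-> x = y \/ In y l.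
Proof.
  induction l as [|z l IH]; intros T Sl.
  - exists (x :: nil); cbn; tauto.
  - destruct Sl as [Hz Sl].
    destruct (classic (x = z)) as [->|ne].
    { exists (z :: l); cbn; tauto. }
    destruct (T z (or_introl eq_refl) ne) as [L|L].
    + exists (x :: z :: l); split; [|cbn; tauto].
      split; [|split; assumption].
      intros y [<-|Hy]; [exact L|apply lex_lt_trans with z; auto].
    + destruct IH as [l' [Sl' Hl']].
      { intros y Hy; apply T; right; exact Hy. }
      { exact Sl. }
      exists (z :: l'); split.
      * split; [|exact Sl']; intros y Hy; apply Hl' in Hy as [<-|Hy]; auto.
      * intro y; cbn; rewrite Hl'; tauto.
Qed.

Lemma lex_sort l :
  (forall x y, In x l -> In y l -> x <> y -> lex_lt x y \/ lex_lt y x) ->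
  exists l', lex_sorted l' /\ forall y, In y l' <-> In y l.
Proof.
  induction l as [|x l IH]; intro T.
  - exists nil; cbn; tauto.
  - destruct IH as [l' [Sl' Hl']].
    { intros; apply T; cbn; auto. }
    destruct (lex_insert x l') as [l'' [Sl'' Hl'']]; [|exact Sl'|].
    { intros y Hy; apply T; cbn; [auto|right; apply Hl', Hy]. }
    exists l''; split; [exact Sl''|]; intro y; cbn; rewrite Hl'', Hl'; tauto.
Qed.

Lemma lex_sorted_consecutive l t : lex_sorted l -> (S t < length l)%nat ->
  lex_lt (nth t l zero_config) (nth (S t) l zero_config) /\
  forall y, In y l -> lex_le y (nth t l zero_config) \/ lex_le (nth (S t) l zero_config) y.
Proof.
  revert t; induction l as [|x l IH]; intros t Sl Ht; cbn [length] in Ht; [lia|].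
  destruct Sl as [Hx Sl].
  destruct t as [|t].
  - destruct l as [|z l]; cbn [length] in Ht; [lia|]; cbn [nth]; split.
    + apply Hx; left; reflexivity.
    + intros y [->|[->|Hy]]; [left; left; auto|right; left; auto|].
      right; right; apply Sl, Hy.
  - destruct (IH t Sl ltac:(lia)) as [L H]; split; [exact L|].
    intros y [<-|Hy]; [|apply H, Hy].
    left; right; cbn [nth]; apply Hx, nth_In; lia.
Qed.

Lemma near_adjacent n x y z : near n x y ->
  is_fixed x -> is_fixed y -> peaked x -> peaked y ->
  (exists C, rep n C z) -> is_fixed z -> peaked z ->
  lex_lt x z -> lex_lt z y -> False.
Proof.
  intros [A [B [RA [RB [I G]]]]] Fx Fy Px Py Rz Fz Pz.
  exact (interlaced_adjacent n A B x y z RA RB I G Fx Fy Px Py Rz Fz Pz).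
Qed.

Lemma near_tri n x y : near n x y ->
  is_fixed x -> is_fixed y -> peaked x -> peaked y -> x <> y -> tri x y.
Proof.
  intros [A [B [RA [RB [I _]]]]]; exact (interlaced_tri n A B x y RA RB I).
Qed.

(** A path through the final level must leave [Q] along some link; downward closure of [Q] then
    excludes the reverse orientation of that link. *)
Lemma fixed_cut n x y (Q : config -> Prop) :
  PSSPM_fixed n x -> PSSPM_fixed n y -> Q x -> ~ Q y ->
  (forall u v, Q v -> lex_lt u v -> Q u) ->
  exists u v, PSSPM_fixed n u /\ PSSPM_fixed n v /\ near n u v /\ tri u v /\ Q u /\ ~ Q v.
Proof.
  intros Fx Fy Qx Qy mono.
  destruct (clos_cut _ _ Q x y
    (level_connected n (S (n * n)) x y (proj1 (PSSPM_fixed_level _ _) Fx)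
      (proj1 (PSSPM_fixed_level _ _) Fy)) Qx Qy) as [u [v [[Lu [Lv N]] [Qu Qv]]]].
  assert (fu := level_fixed _ _ Lu); assert (fv := level_fixed _ _ Lv).
  assert (pu := proj1 (level_tame _ _ _ Lu)); assert (pv := proj1 (level_tame _ _ _ Lv)).
  assert (ne : u <> v) by (intros ->; contradiction).
  destruct N as [N|N].
  - exists u, v; split; [apply PSSPM_fixed_level, Lu|].
    split; [apply PSSPM_fixed_level, Lv|].
    split; [exact N|]; split; [apply (near_tri n); assumption|auto].
  - exfalso; apply Qv, (mono v u Qu), tri_lex_lt.
    apply (near_tri n); auto.
Qed.

Theorem theorem1 (n : nat) :
  exists l : list config,
    l <> nil /\
    (forall t, (S t < length l)%nat ->
       lex_lt (nth t l zero_config) (nth (S t) l zero_config)) /\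
    (forall c, In c l <-> PSSPM_fixed n c) /\
    (forall t, (S t < length l)%nat ->
       tri (nth t l zero_config) (nth (S t) l zero_config)) /\
    (forall p, SSPM_fixed n p ->
       lex_le (hd zero_config l) p -> lex_le p (last l zero_config) -> In p l).
Proof.
  destruct (level_finite n (S (n * n))) as [l0 Hl0].
  assert (tameP : forall c, PSSPM_fixed n c -> is_fixed c /\ peaked c /\ exists A, rep n A c).
  { intros c Fc; apply PSSPM_fixed_level in Fc.
    assert (T := level_tame _ _ _ Fc); split; [exact (level_fixed n c Fc)|].
    split; [apply T|]; destruct (near_self _ _ (proj2 T)) as [A [RA _]]; eauto. }
  destruct (lex_sort l0) as [l [Sl Hl]].
  { intros x y Hx Hy; apply Hl0, PSSPM_fixed_level, tameP in Hx, Hy.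
    destruct Hx as [_ [_ [A RA]]], Hy as [_ [_ [B RB]]].
    exact (lex_total n A B x y RA RB). }
  assert (InP : forall c, In c l <-> PSSPM_fixed n c).
  { intro c; rewrite Hl, Hl0, PSSPM_fixed_level; tauto. }
  assert (nl : l <> nil).
  { assert (ex : forall t, exists c, level n t c).
    { induction t as [|t [c Lc]]; [exists (single n); reflexivity|].
      exists (next c (fun _ => true)), c; split; [exact Lc|apply next_step]. }
    destruct (ex (S (n * n))) as [c Lc]; intros ->.
    apply PSSPM_fixed_level, InP in Lc; exact Lc. }
  exists l; split; [exact nl|split; [|split; [exact InP|split]]].
  - intros t Ht; apply (lex_sorted_consecutive l t Sl Ht).
  - intros t Ht; destruct (lex_sorted_consecutive l t Sl Ht) as [L H].
    assert (I1 : In (nth t l zero_config) l) by (apply nth_In; lia).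
    assert (I2 : In (nth (S t) l zero_config) l) by (apply nth_In; lia).
    set (a := nth t l zero_config) in *; set (b := nth (S t) l zero_config) in *.
    (* Cutting just below [b] yields related [u < b <= v]; adjacency will identify [v] with [b] and
       then [u] with [a]. *)
    destruct (fixed_cut n a b (fun c => lex_lt c b)) as
      [u [v [Fu [Fv [N [Tuv [Qu Qv]]]]]]].
    + apply InP, I1.
    + apply InP, I2.
    + exact L.
    + apply lex_lt_irrefl.
    + intros u v vb uv; exact (lex_lt_trans _ _ _ uv vb).
    + destruct (tameP u Fu) as [fu [pu ru]], (tameP v Fv) as [fv [pv rv]].
      destruct (tameP b (proj1 (InP b) I2)) as [fb [pb rb]].
      destruct (tameP a (proj1 (InP a) I1)) as [fa [pa ra]].
      assert (ua : lex_le u a).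
      { destruct (H u (proj2 (InP u) Fu)) as [|[<-|C]]; [assumption| |]; exfalso.
        - exact (lex_lt_irrefl _ Qu).
        - exact (lex_lt_irrefl _ (lex_lt_trans _ _ _ Qu C)). }
      assert (bv : b = v).
      { destruct (classic (b = v)) as [|ne]; [assumption|exfalso].
        destruct rb as [B RB], rv as [V RV].
        destruct (lex_total n B V b v RB RV ne) as [C|C]; [|contradiction].
        apply (near_adjacent n u v b); auto; exists B; exact RB. }
      subst v; destruct ua as [<-|ua]; [exact Tuv|exfalso].
      apply (near_adjacent n u b a); auto.
  - intros p [Rp Fp] lo hi.
    destruct (sspm_reachable_peaked n p Rp) as [Pp Ap].
    destruct (classic (In p l)) as [|Np]; [assumption|exfalso].
    assert (I1 : In (hd zero_config l) l) by (destruct l; [contradiction|left; auto]).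
    assert (I2 : In (last l zero_config) l).
    { destruct (exists_last nl) as [l1 [z E]]; rewrite E, last_last.
      apply in_or_app; right; left; reflexivity. }
    destruct lo as [E|lo]; [rewrite E in I1; contradiction|].
    destruct hi as [E|hi]; [rewrite <- E in I2; contradiction|].
    (* Cutting at the missing [p] yields related [u < p < v], which adjacency forbids because [p] is
       itself stable and peaked. *)
    destruct (fixed_cut n (hd zero_config l) (last l zero_config)
      (fun c => lex_lt c p)) as [u [v [Fu [Fv [N [_ [Qu Qv]]]]]]].
    + apply InP, I1.
    + apply InP, I2.
    + exact lo.
    + intro C; exact (lex_lt_irrefl _ (lex_lt_trans _ _ _ hi C)).
    + intros u v vp uv; exact (lex_lt_trans _ _ _ uv vp).
    + destruct (tameP u Fu) as [fu [pu _]], (tameP v Fv) as [fv [pv [V RV]]].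
      destruct Ap as [A RA].
      assert (ne : p <> v) by (intros ->; apply Np, InP, Fv).
      destruct (lex_total n A V p v RA RV ne) as [C|C]; [|contradiction].
      apply (near_adjacent n u v p); eauto.
Qed.
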